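(* Let $X_1,\dots,X_n$ be independent and identically distributed random variables with distribution function $F$, and let $X_{1:n}=\min(X_1,\dots,X_n)$. Consider the conditional random variables $Z_1^{(n,t)}=(X_1\mid X_{1:n}\le t)$, $Z_2^{(n,t)}=(X_2\mid X_{1:n}\le t),\dots,Z_n^{(n,t)}=(X_n\mid X_{1:n}\le t)$. The random variables $Z_1^{(n,t)},Z_2^{(n,t)},\dots,Z_n^{(n,t)}$ are dependent.
   Context: $F(x)=P\{X_1\le x\}$. The conditional random variables $(X_1\mid A),\dots,(X_n\mid A)$, for an event $A$ with $P(A)>0$, are random variables whose joint law is the conditional law of $(X_1,\dots,X_n)$ given $A$, i.e. with joint distribution function $P\{X_1\le x_1,\dots,X_n\le x_n\mid A\}$. Dependent means not independent.
   Formalization: The claim is proved for n ≥ 2 and F(t) < 1 (with P(X_{1:n} ≤ t) > 0); if F(t) = 1 the conditioning event has probability 1 and the Z_i are independent, and for n = 1 a single variable is trivially independent. *)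

(* Defs.v *)
From HB Require Import structures.
From mathcomp Require Import all_boot all_order all_algebra.
From mathcomp Require Import all_classical all_reals all_analysis.

Set Implicit Arguments.
Unset Strict Implicit.
Unset Printing Implicit Defensive.

Import Order.TTheory GRing.Theory Num.Theory.
Import numFieldNormedType.Exports.

Local Open Scope classical_set_scope.
Local Open Scope ring_scope.

Section defs.
Context {d : measure_display} {T : measurableType d} {R : realType}.
Variable P : probability T R.

(* Mutual independence: the product rule over every subfamily. *)
Definition independent_RVs (I : finType) (X : I -> {RV P >-> R}) : Prop :=
  forall (J : {set I}) (B : I -> set R), (forall i, measurable (B i)) ->
    (P (\bigcap_(i in [set` J]) (X i @^-1` B i)) =
     \prod_(i in J) P (X i @^-1` B i))%E.

Definition identically_distributed (I : finType) (X : I -> {RV P >-> R})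
    : Prop :=
  forall (i j : I) (B : set R), measurable B ->
    distribution P (X i) B = distribution P (X j) B.

(* At least one variable is required, so the family is indexed by 'I_n.+1. *)
Definition sample_min (n : nat) (X : 'I_n.+1 -> {RV P >-> R}) (w : T) : R :=
  \big[Num.min/X ord0 w]_(i < n.+1) X i w.

Definition cond_prob (E A : set T) : \bar R := (P (E `&` A) / P A)%E.

Definition joint (n : nat) (X : 'I_n -> {RV P >-> R}) (w : T) : n.-tuple R :=
  [tuple X i w | i < n].

End defs.

(* Z, which may live on another probability space, is a version of
   ((X_0 | A), ..., (X_(n-1) | A)): its joint law, on the product sigma-algebra
   of n.-tuple R, is the conditional law of (X_0, ..., X_(n-1)) given A. *)
Definition conditional_RVs (R : realType)
    (d : measure_display) (T : measurableType d) (P : probability T R)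
    (d' : measure_display) (T' : measurableType d') (Q : probability T' R)
    (n : nat) (X : 'I_n -> {RV P >-> R}) (A : set T)
    (Z : 'I_n -> {RV Q >-> R}) : Prop :=
  forall B : set (n.-tuple R), measurable B ->
    Q (joint Z @^-1` B) = cond_prob P (joint X @^-1` B) A.

(* Main.v *)
Require Import Defs.
From HB Require Import structures.
From mathcomp Require Import all_boot all_order all_algebra.
From mathcomp Require Import all_classical all_reals all_analysis.

Import Order.TTheory GRing.Theory Num.Theory.
Import numFieldNormedType.Exports.

Local Open Scope classical_set_scope.
Local Open Scope ring_scope.

(** Write [A] for the event that the minimum of the sample is at most [t].
    Given [A], some coordinate is at most [t], so the event that all the
    [Z i] exceed [t] is null.  If the [Z i] were independent, the product of
    the probabilities of the events [Z i > t] would vanish, hence one of its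
    factors would ([prode_eq0]): [X i > t] and [A] almost never occur together.
    But [A] contains [X j <= t] for any [j != i], so the events [X i > t] and
    [X j <= t], independent by hypothesis, almost never occur together either:
    one of them is null.  The first has probability [1 - F t > 0]; and if the
    second is null, then, the [X k] having the same law, [A] is a finite union
    of null events, which contradicts [0 < P A]. *)

(** Nonzero extended reals are closed under multiplication, infinities
    included, an infinite factor being absorbed only by 0. *)
Lemma prode_eq0 (R : realType) (I : finType) (f : I -> \bar R) :
  (\prod_i f i = 0)%E -> exists i, f i = 0%E.
Proof.
move=> prod0; apply: contrapT => f_neq0.
suff : (\prod_i f i != 0)%E by rewrite prod0 eqxx.
apply: (big_ind (fun x : \bar R => x != 0%E)) => [|x y x0 y0|i _].
- by rewrite onee_neq0.
- by rewrite mule_eq0 negb_or x0.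
- by apply/eqP => fi0; apply: f_neq0; exists i.
Qed.

Section random_variables.
Context {d : measure_display} {T : measurableType d} {R : realType}.
Variable P : probability T R.

Lemma independent_RVs_pair (I : finType) (X : I -> {RV P >-> R}) (i j : I)
    (B C : set R) :
  independent_RVs X -> i != j -> measurable B -> measurable C ->
  (P (X i @^-1` B `&` X j @^-1` C) = P (X i @^-1` B) * P (X j @^-1` C))%E.
Proof.
move=> indep ij mB mC.
(* The product rule over the pair needs one family of Borel sets on all of I. *)
pose D k := if k == i then B else C.
have mD k : measurable (D k) by rewrite /D; case: ifP.
have := indep [set i; j]%SET D mD.
rewrite big_setU1 ?inE//= big_set1 /D eqxx [j == i]eq_sym (negbTE ij) => <-.
congr (P _); apply/seteqP; split => w /=.
  move=> [wB wC] k /=; rewrite !inE => /orP[] /eqP->; first by rewrite eqxx.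
  by rewrite eq_sym (negbTE ij).
move=> wD; split.
  by have := wD i; rewrite /= !inE !eqxx; exact.
by have := wD j; rewrite /= !inE eqxx orbT eq_sym (negbTE ij); exact.
Qed.

(** The default value [X ord0 w] of the iterated minimum is itself a sample
    value, so it contributes no event of its own to the union. *)
Lemma sample_min_leE (n : nat) (X : 'I_n.+1 -> {RV P >-> R}) (t : R) :
  [set w | sample_min X w <= t] =
  \big[setU/set0]_(i < n.+1) (X i @^-1` `]-oo, t]).
Proof.
rewrite -bigcup_mkord_ord; apply/seteqP; split => w /=.
  move=> /bigmin_leP[Xt|[i _ Xt]].
    by exists 0%N => //=; rewrite in_itv/= (_ : inord 0 = ord0)//;
      apply/val_inj; rewrite /= inordK.
  by exists i => //=; rewrite inord_val in_itv.
move=> [k kn /=]; rewrite in_itv/= => Xt.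
by apply/bigmin_leP; right; exists (inord k).
Qed.

End random_variables.

Theorem proposition2 (R : realType)
    (d : measure_display) (T : measurableType d) (P : probability T R)
    (n : nat) (X : 'I_n.+1 -> {RV P >-> R}) (F : R -> R) (t : R)
    (n_ge2 : (2 <= n.+1)%N)
    (X_indep : independent_RVs X)
    (X_ident : identically_distributed X)
    (X_cdf : forall x : R, cdf (X ord0) x = (F x)%:E)
    (A_pos : (0 < P [set w | (sample_min X w <= t)%R])%E)
    (Ft_lt1 : F t < 1)
    (d' : measure_display) (T' : measurableType d') (Q : probability T' R)
    (Z : 'I_n.+1 -> {RV Q >-> R})
    (Z_cond : conditional_RVs X [set w | (sample_min X w <= t)%R] Z) :
  ~ independent_RVs Z.
Proof.
set A := [set w | _] in A_pos Z_cond.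
have AE : A = \big[setU/set0]_(i < n.+1) (X i @^-1` `]-oo, t]).
  exact: sample_min_leE.
have mle i : measurable (X i @^-1` `]-oo, t]) by exact: measurable_funPTI.
have mgt i : measurable (X i @^-1` `]t, +oo[) by exact: measurable_funPTI.
have mA : measurable A by rewrite AE; exact: bigsetU_measurable.
have XleF i : P (X i @^-1` `]-oo, t]) = (F t)%:E.
  by rewrite -X_cdf; exact: X_ident.
have Xgt i : P (X i @^-1` `]t, +oo[) != 0%E.
  rewrite -setCitvl -preimage_setC (probability_setC P (mle i)) XleF -EFinB eqe.
  by rewrite subr_eq0 gt_eqF.
move=> Z_indep.
(* The hypothesis on Z speaks only of its joint law: the events Z i > t are
   read as preimages of half-spaces of tuples. *)
pose H := fun i => [set u : n.+1.-tuple R | tnth u i > t].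
have mH i : measurable (H i).
  rewrite (_ : H i = (@tnth _ _)^~ i @^-1` `]t, +oo[).
    by rewrite -[X in measurable X]setTI; exact: measurable_tnth.
  by apply/seteqP; split => u; rewrite /H /= in_itv/= andbT.
have jointH (dd : measure_display) (S : measurableType dd) (M : probability S R)
    (Y : 'I_n.+1 -> {RV M >-> R}) i :
    joint Y @^-1` H i = Y i @^-1` `]t, +oo[.
  by apply/seteqP; split => w; rewrite /H /= tnth_mktuple in_itv/= andbT.
have Zall0 : Q (\bigcap_(i in [set` [set: 'I_n.+1]%SET]) (Z i @^-1` `]t, +oo[))
    = 0%E.
  transitivity (Q (joint Z @^-1` \bigcap_i H i)).
    congr (Q _); apply/seteqP; split => w Zw i.
      by have := Zw i; rewrite -jointH /= inE => Zwi _; exact: Zwi.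
    by rewrite -jointH => _; exact: Zw.
  rewrite Z_cond; last exact: fin_bigcap_measurable.
  rewrite /cond_prob (_ : _ `&` A = set0) ?measure0 ?mul0e//.
  rewrite -subset0 => w [Xw]; rewrite AE -bigcup_mkord_ord => -[k kn].
  rewrite /= in_itv/= => Xk.
  have := Xw (inord k) I; rewrite /H /= tnth_mktuple.
  by rewrite ltNge Xk.
have [i Zi0] : exists i, Q (Z i @^-1` `]t, +oo[) = 0%E.
  apply: prode_eq0; rewrite -Zall0 Z_indep//.
  by apply: eq_bigl => i; rewrite inE.
(* A conditional probability vanishes only if its numerator does, the inverse
   of the finite number P A being nonzero. *)
have XiA0 : P (X i @^-1` `]t, +oo[ `&` A) = 0%E.
  move: Zi0; rewrite -jointH Z_cond// jointH /cond_prob => /eqP.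
  rewrite mule_eq0 inve_eq0 => /orP[/eqP//|/eqP PAoo].
  by have : P A \is a fin_num; [exact: fin_num_measure | rewrite PAoo].
have [j ij] : exists j, i != j.
  have [->|i0] := eqVneq i ord0; last by exists ord0.
  by exists ord_max; rewrite -val_eqE /= eq_sym -lt0n.
have : P (X i @^-1` `]t, +oo[ `&` X j @^-1` `]-oo, t]) = 0%E.
  apply: (subset_measure0 _ _ _ XiA0) => //; try exact: measurableI.
  apply: setIS => w Xjw; rewrite AE -bigcup_mkord_ord.
  by exists j => //=; rewrite inord_val.
rewrite independent_RVs_pair// => /eqP.
rewrite mule_eq0 (negbTE (Xgt i)) /= XleF => /eqP Ft0.
have : (P A <= 0)%E.
  (* Boole's inequality ranges over a sequence of events, hence inord. *)
  pose E k := X (inord k) @^-1` `]-oo, t].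
  have mE k : (k < n.+1)%N -> measurable (E k) by move=> _; exact: mle.
  rewrite AE -bigcup_mkord_ord bigcup_mkord (le_trans (Boole_inequality _ mE))//.
  by rewrite big1// => k _; apply: etrans (XleF (inord k)) Ft0.
by rewrite leNgt A_pos.
Qed.
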